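(* Let $\mathbf{Z}^k=(\mathbf{D}^k,\mathbf{W}^k,\mathbf{C}^k,\mathbf{U}^k,\Lambda_{\mathbf{D}}^k,\Lambda_{\mathbf{W}}^k)$, $k=1,2,\dots$, be a sequence generated by the L1FS algorithm (described in the context) that satisfies $$\lim_{k\to\infty}(\mathbf{Z}^{k+1}-\mathbf{Z}^k)=\mathbf{0}.$$ Then any accumulation point of $\{\mathbf{Z}^k\}_{k=1}^\infty$ is a KKT point of the constrained problem $$\min_{\mathbf{D},\mathbf{W},\mathbf{C},\mathbf{U}}\ \sum_{i=1}^N\sum_{x\in\Omega}\Big\{\|d_i(x)\|+\lambda|I(x)-c_i|\,w_i(x)\Big\}+\delta_\Delta(\mathbf{W})\quad\text{subject to}\quad \nabla u_i=d_i,\ u_i=w_i,\ i=1,\dots,N.$$ Consequently, any accumulation point of $\{(\mathbf{C}^k,\mathbf{U}^k)\}_{k=1}^\infty$ is a stationary point of the problem $$\min_{(\mathbf{U},\mathbf{C})\in\Delta\times\mathbb{R}^{sN}}E(\mathbf{U},\mathbf{C})=\sum_{i=1}^N\sum_{x\in\Omega}\Big\{\|\nabla u_i(x)\|+\lambda|I(x)-c_i|\,u_i(x)\Big\}.$$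
   Context: Setting (discrete): $\Omega$ is a finite set of $n$ pixels, $N\ge1$ an integer, $s\in\{1,3\}$, $I:\Omega\to\mathbb{R}^s$ a given image, $\lambda>0$ and $r>0$ constants. $|\cdot|$ is a fixed norm on $\mathbb{R}^s$ (absolute value if $s=1$) and $\|\cdot\|$ is the Euclidean norm on $\mathbb{R}^2$. $\nabla$ is the discrete gradient, a fixed linear operator from functions $\Omega\to\mathbb{R}$ to functions $\Omega\to\mathbb{R}^2$, $\nabla^T$ is its transpose, and $\mathbf{I}$ is the identity. Variables: $\mathbf{U}=(u_1,\dots,u_N)$, $\mathbf{W}=(w_1,\dots,w_N)$, $\Lambda_{\mathbf{W}}=(\lambda_{w_1},\dots,\lambda_{w_N})$ with $u_i,w_i,\lambda_{w_i}:\Omega\to\mathbb{R}$; $\mathbf{D}=(d_1,\dots,d_N)$, $\Lambda_{\mathbf{D}}=(\lambda_{d_1},\dots,\lambda_{d_N})$ with $d_i,\lambda_{d_i}:\Omega\to\mathbb{R}^2$; $\mathbf{C}=(c_1,\dots,c_N)$ with $c_i\in\mathbb{R}^s$. $|I-\mathbf{C}|$ denotes the $N$-tuple of functions $x\mapsto|I(x)-c_i|$. Operators $\nabla,\nabla^T$ act on each component of an $N$-tuple. $\Delta=\{(u_1,\dots,u_N): u_i(x)\ge0,\ \sum_{i=1}^Nu_i(x)=1\ \forall x\in\Omega\}$; $\delta_\Delta$ is its indicator function ($0$ on $\Delta$, $+\infty$ otherwise); $\Pi_\Delta$ is the Euclidean projection onto $\Delta$. The shrinkage operator, applied at each pixel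 and for each component, is $\mathcal{S}(v,\tau)=\frac{v}{\|v\|}\max(\|v\|-\tau,0)$ for $v\in\mathbb{R}^2$, with $\mathcal{S}(0,\tau)=0$. $\psi(\mathbf{W})$ is the $N$-tuple whose $i$-th entry is a minimizer over $c\in\mathbb{R}^s$ of $\sum_{x\in\Omega}|I(x)-c|\,w_i(x)$ (for $s=1$: the smallest minimizer); the algorithm is assumed to run so that this is well defined, i.e. no $w_i^{k+1}$ is identically zero. L1FS algorithm: $\mathbf{U}^0$, $\mathbf{C}^0$ are given, $\Lambda_{\mathbf{D}}^0=\mathbf{0}$, $\Lambda_{\mathbf{W}}^0=\mathbf{0}$, and for $k=0,1,2,\dots$ $$\mathbf{D}^{k+1}=\mathcal{S}\Big(\nabla\mathbf{U}^k+\tfrac{\Lambda_{\mathbf{D}}^k}{r},\tfrac1r\Big),$$ $$\mathbf{W}^{k+1}=\Pi_\Delta\Big(\mathbf{U}^k+\tfrac{\Lambda_{\mathbf{W}}^k}{r}-\tfrac{\lambda|I-\mathbf{C}^k|}{r}\Big),$$ $$\mathbf{C}^{k+1}=\psi(\mathbf{W}^{k+1}),$$ $$\mathbf{U}^{k+1}=(\nabla^T\nabla+\mathbf{I})^{-1}\Big(\nabla^T\mathbf{D}^{k+1}+\mathbf{W}^{k+1}-\tfrac{\nabla^T\Lambda_{\mathbf{D}}^k}{r}-\tfrac{\Lambda_{\mathbf{W}}^k}{r}\Big),$$ $$\Lambda_{\mathbf{D}}^{k+1}=\Lambda_{\mathbf{D}}^k+r(\nabla\mathbf{U}^{k+1}-\mathbf{D}^{k+1}),\qquad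 \Lambda_{\mathbf{W}}^{k+1}=\Lambda_{\mathbf{W}}^k+r(\mathbf{U}^{k+1}-\mathbf{W}^{k+1}).$$ KKT point: $\mathbf{Z}=(\mathbf{D},\mathbf{W},\mathbf{C},\mathbf{U},\Lambda_{\mathbf{D}},\Lambda_{\mathbf{W}})$ is a KKT point of the constrained problem if, for all $i$ and all $x\in\Omega$, $$0\in\partial\|d_i(x)\|-\lambda_{d_i}(x),\qquad \mathbf{0}\in\lambda|I-\mathbf{C}|-\Lambda_{\mathbf{W}}+\partial\delta_\Delta(\mathbf{W}),\qquad 0\in\sum_{x\in\Omega}\partial|I(x)-c_i|\,w_i(x),$$ $$\nabla^T\lambda_{d_i}(x)+\lambda_{w_i}(x)=0,\qquad \nabla u_i(x)-d_i(x)=0,\qquad u_i(x)-w_i(x)=0,$$ where $\partial\|d_i(x)\|$, $\partial|I(x)-c_i|$ are the convex subdifferentials of $\|\cdot\|$ at $d_i(x)$ and of $|\cdot|$ at $I(x)-c_i$, and $\partial\delta_\Delta$ is the convex subdifferential of $\delta_\Delta$. Stationary point: $(\mathbf{C},\mathbf{U})$ is a stationary point of $\min_{\Delta\times\mathbb{R}^{sN}}E$ if it satisfies the first-order conditions $\mathbf{0}\in\partial_{\mathbf{U}}\big(E(\cdot,\mathbf{C})+\delta_\Delta\big)(\mathbf{U})$ and $0\in\sum_{x\in\Omega}\partial|I(x)-c_i|\,u_i(x)$ for each $i$, where $\partial_{\mathbf{U}}$ is the convex subdifferential in $\mathbf{U}$. *)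

(* Defs.v *)
From HB Require Import structures.
From mathcomp Require Import all_boot all_order all_algebra.
From mathcomp Require Import all_classical all_reals all_analysis.
Set Implicit Arguments.
Unset Strict Implicit.
Unset Printing Implicit Defensive.
Import Order.TTheory GRing.Theory Num.Theory.
Import numFieldNormedType.Exports.
Local Open Scope classical_set_scope.
Local Open Scope ring_scope.

(* Conventions.  The pixel set is 'I_n.  A function from pixels to reals is a
   'cV[R]_n and a function from pixels to R^p is an 'M[R]_(n, p), whose row x
   is the value at pixel x.  An N-tuple of real functions is an 'M[R]_(n, N)
   (column i is its i-th entry), an N-tuple of R^2-valued functions is an
   'M['rV[R]_2]_(n, N), and an N-tuple of points of R^s is an 'M[R]_(N, s)
   (row i is its i-th entry).  All these carry the usual product topology. *)

Definition mxdot (R : realType) (m p : nat) (A B : 'M[R]_(m, p)) : R :=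
  \sum_i \sum_j A i j * B i j.

Definition enorm (R : realType) (m p : nat) (A : 'M[R]_(m, p)) : R :=
  Num.sqrt (mxdot A A).

Definition is_norm (R : realType) (s : nat) (nu : 'rV[R]_s -> R) : Prop :=
  [/\ forall v w, nu (v + w) <= nu v + nu w,
      forall (a : R) v, nu (a *: v) = `|a| * nu v
    & forall v, nu v = 0 -> v = 0].

Definition subdiff (R : realType) (m p : nat) (f : 'M[R]_(m, p) -> \bar R)
    (X : 'M[R]_(m, p)) : set 'M[R]_(m, p) :=
  [set G | forall Y, (f X + (mxdot G (Y - X))%:E <= f Y)%E].

Definition is_minimizer (R : realType) (T : Type) (f : T -> R) (c : T) : Prop :=
  forall c', f c <= f c'.

(* [P] is the Euclidean projection of [X] onto [A]. *)
Definition is_proj (R : realType) (m p : nat) (A : set 'M[R]_(m, p))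
    (X P : 'M[R]_(m, p)) : Prop :=
  A P /\ forall Q, A Q -> enorm (X - P) <= enorm (X - Q).

Definition simplex (R : realType) (n N : nat) : set 'M[R]_(n, N) :=
  [set U | forall x, (forall i, 0 <= U x i) /\ \sum_i U x i = 1].

Definition indic_simplex (R : realType) (n N : nat) (U : 'M[R]_(n, N)) :
    \bar R :=
  if U \in @simplex R n N then 0%E else +oo%E.

(* At v = 0 the quotient is x / 0 = 0, so that shrink 0 tau = 0. *)
Definition shrink (R : realType) (v : 'rV[R]_2) (tau : R) : 'rV[R]_2 :=
  (Num.max (enorm v - tau) 0 / enorm v) *: v.

(* i-th entry of an N-tuple of R^2-valued functions. *)
Definition vcol (R : realType) (n N : nat) (i : 'I_N)
    (D : 'M['rV[R]_2]_(n, N)) : 'M[R]_(n, 2) :=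
  \matrix_(x, j) D x i 0 j.

Definition gradn (R : realType) (n N : nat)
    (grad : {linear 'cV[R]_n -> 'M[R]_(n, 2)}) (U : 'M[R]_(n, N)) :
    'M['rV[R]_2]_(n, N) :=
  \matrix_(x, i) row x (grad (col i U)).

(* [lin_mx grad] is the matrix of [grad] in the canonical bases, acting on
   row vectors. *)
Definition gradT (R : realType) (n : nat)
    (grad : {linear 'cV[R]_n -> 'M[R]_(n, 2)}) (p : 'M[R]_(n, 2)) : 'cV[R]_n :=
  vec_mx (mxvec p *m (lin_mx grad)^T).

Definition gradTn (R : realType) (n N : nat)
    (grad : {linear 'cV[R]_n -> 'M[R]_(n, 2)}) (D : 'M['rV[R]_2]_(n, N)) :
    'M[R]_(n, N) :=
  \matrix_(x, i) gradT grad (vcol i D) x 0.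

(* The inverse of a linear operator, through its matrix.  [invmx] is the
   identity on singular matrices, but grad^T grad + I, the only operator it is
   used on, is always invertible. *)
Definition opinv (R : realType) (n : nat) (A : 'cV[R]_n -> 'cV[R]_n)
    (b : 'cV[R]_n) : 'cV[R]_n :=
  vec_mx (mxvec b *m invmx (lin_mx A)).

(* (grad^T grad + I)^-1, acting on each entry of an N-tuple. *)
Definition solven (R : realType) (n N : nat)
    (grad : {linear 'cV[R]_n -> 'M[R]_(n, 2)}) (B : 'M[R]_(n, N)) :
    'M[R]_(n, N) :=
  \matrix_(x, i) opinv (fun u => gradT grad (grad u) + u) (col i B) x 0.

(* The N-tuple of functions x |-> |I(x) - c_i|. *)
Definition absdiff (R : realType) (n N s : nat) (nu : 'rV[R]_s -> R)
    (I : 'M[R]_(n, s)) (C : 'M[R]_(N, s)) : 'M[R]_(n, N) :=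
  \matrix_(x, i) nu (row x I - row i C).

Definition fitting (R : realType) (n s : nat) (nu : 'rV[R]_s -> R)
    (I : 'M[R]_(n, s)) (w : 'cV[R]_n) (c : 'rV[R]_s) : R :=
  \sum_x nu (row x I - c) * w x 0.

(* [C] is a value of psi(W); for s = 1 it is the smallest minimizer. *)
Definition is_psi (R : realType) (n N s : nat) (nu : 'rV[R]_s -> R)
    (I : 'M[R]_(n, s)) (W : 'M[R]_(n, N)) (C : 'M[R]_(N, s)) : Prop :=
  forall i, is_minimizer (fitting nu I (col i W)) (row i C) /\
    (s = 1%N -> forall c, is_minimizer (fitting nu I (col i W)) c ->
       forall j, C i j <= c 0 j).

(* The values of D and W at index 0 are not constrained (nor used). *)
Definition is_L1FS (R : realType) (n N s : nat) (nu : 'rV[R]_s -> R)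
    (I : 'M[R]_(n, s)) (lam r : R)
    (grad : {linear 'cV[R]_n -> 'M[R]_(n, 2)})
    (D : nat -> 'M['rV[R]_2]_(n, N)) (W : nat -> 'M[R]_(n, N))
    (C : nat -> 'M[R]_(N, s)) (U : nat -> 'M[R]_(n, N))
    (LD : nat -> 'M['rV[R]_2]_(n, N)) (LW : nat -> 'M[R]_(n, N)) : Prop :=
  [/\ LD 0%N = 0, LW 0%N = 0 & forall k : nat,
    [/\ forall x i, D k.+1 x i =
          shrink (gradn grad (U k) x i + r^-1 *: LD k x i) r^-1,
        is_proj (@simplex R n N)
          (U k + r^-1 *: LW k - (lam / r) *: absdiff nu I (C k)) (W k.+1),
        (forall i, col i (W k.+1) != 0) /\ is_psi nu I (W k.+1) (C k.+1),
        U k.+1 = solven grad (gradTn grad (D k.+1) + W k.+1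
                   - r^-1 *: gradTn grad (LD k) - r^-1 *: LW k)
      & (forall x i, LD k.+1 x i =
           LD k x i + r *: (gradn grad (U k.+1) x i - D k.+1 x i)) /\
        LW k.+1 = LW k + r *: (U k.+1 - W k.+1)]].

(* Order of the components: D, W, C, U, Lambda_D, Lambda_W. *)
Notation L1FS_state R n N s :=
  ('M['rV[R]_2]_(n, N) * 'M[R]_(n, N) * 'M[R]_(N, s) * 'M[R]_(n, N) *
   'M['rV[R]_2]_(n, N) * 'M[R]_(n, N))%type (only parsing).

(* 0 \in \sum_x (subdifferential of nu at I(x) - c) w(x), a Minkowski sum. *)
Definition c_stationary (R : realType) (n s : nat) (nu : 'rV[R]_s -> R)
    (I : 'M[R]_(n, s)) (w : 'cV[R]_n) (c : 'rV[R]_s) : Prop :=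
  exists g : 'I_n -> 'rV[R]_s,
    (forall x, subdiff (fun v => (nu v)%:E) (row x I - c) (g x)) /\
    \sum_x w x 0 *: g x = 0.

Definition is_KKT (R : realType) (n N s : nat) (nu : 'rV[R]_s -> R)
    (I : 'M[R]_(n, s)) (lam : R)
    (grad : {linear 'cV[R]_n -> 'M[R]_(n, 2)})
    (D : 'M['rV[R]_2]_(n, N)) (W : 'M[R]_(n, N)) (C : 'M[R]_(N, s))
    (U : 'M[R]_(n, N)) (LD : 'M['rV[R]_2]_(n, N)) (LW : 'M[R]_(n, N)) : Prop :=
  [/\ forall x i,
        [set g - LD x i | g in subdiff (fun v => (enorm v)%:E) (D x i)] 0,
      [set lam *: absdiff nu I C - LW + G
         | G in subdiff (@indic_simplex R n N) W] 0,
      forall i, c_stationary nu I (col i W) (row i C),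
      forall x i, gradTn grad LD x i + LW x i = 0
    & (forall x i, gradn grad U x i - D x i = 0) /\
      (forall x i, U x i - W x i = 0)].

Definition energy (R : realType) (n N s : nat) (nu : 'rV[R]_s -> R)
    (I : 'M[R]_(n, s)) (lam : R)
    (grad : {linear 'cV[R]_n -> 'M[R]_(n, 2)})
    (U : 'M[R]_(n, N)) (C : 'M[R]_(N, s)) : R :=
  \sum_i \sum_x (enorm (gradn grad U x i)
                 + lam * nu (row x I - row i C) * U x i).

Definition is_stationary (R : realType) (n N s : nat) (nu : 'rV[R]_s -> R)
    (I : 'M[R]_(n, s)) (lam : R)
    (grad : {linear 'cV[R]_n -> 'M[R]_(n, 2)})
    (C : 'M[R]_(N, s)) (U : 'M[R]_(n, N)) : Prop :=
  subdiff (fun V => (energy nu I lam grad V C)%:E + indic_simplex V)%E U 0 /\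
  forall i, c_stationary nu I (col i U) (row i C).

(* Main.v *)
(* Each step of the algorithm satisfies the optimality conditions of its
   subproblems: a subgradient inequality for D, a variational inequality for W,
   minimality for C, and grad^T Lambda_D + Lambda_W = 0 (after simplification,
   this is the linear system that defines U).  If successive differences tend
   to 0, the multiplier updates force grad U - D -> 0 and U - W -> 0, so these
   conditions pass to the limit along a subsequence; the limit minimality of C
   is turned into the Minkowski-sum condition by a Hahn-Banach argument in
   finite dimension.
   An accumulation point of (C, U) alone says nothing about the multipliers.
   However the subgradients of the Euclidean norm have norm at most 1, so
   Lambda_D stays bounded; adding up the inequalities for D and W, the
   multipliers cancel by adjointness up to terms bounded by the residuals, and
   the energy inequality follows in the limit. *)
Require Import Defs.
From HB Require Import structures.
From mathcomp Require Import all_boot all_order all_algebra.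
From mathcomp Require Import all_classical all_reals all_analysis.
From mathcomp Require Import ring lra.
Import Order.TTheory GRing.Theory Num.Theory.
Import numFieldNormedType.Exports.
Local Open Scope classical_set_scope.
Local Open Scope ring_scope.

(** * Entrywise inner product and Euclidean norm on matrices *)

Section Dot.
Context {R : realType} {m p : nat}.
Implicit Types (A B X Y : 'M[R]_(m, p)) (a : R).

Lemma mxdotC A B : mxdot A B = mxdot B A.
Proof. by apply: eq_bigr => i _; apply: eq_bigr => j _; rewrite mulrC. Qed.

Lemma mxdotDl A B X : mxdot (A + B) X = mxdot A X + mxdot B X.
Proof.
rewrite -big_split; apply: eq_bigr => i _ /=.
by rewrite -big_split; apply: eq_bigr => j _; rewrite mxE mulrDl.
Qed.

Lemma mxdotZl a A X : mxdot (a *: A) X = a * mxdot A X.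
Proof.
rewrite mulr_sumr; apply: eq_bigr => i _.
by rewrite mulr_sumr; apply: eq_bigr => j _; rewrite mxE mulrA.
Qed.

Lemma mxdotDr A B X : mxdot X (A + B) = mxdot X A + mxdot X B.
Proof. by rewrite mxdotC mxdotDl !(mxdotC X). Qed.

Lemma mxdotZr a A X : mxdot X (a *: A) = a * mxdot X A.
Proof. by rewrite mxdotC mxdotZl mxdotC. Qed.

Lemma mxdotNl A X : mxdot (- A) X = - mxdot A X.
Proof. by rewrite -scaleN1r mxdotZl mulN1r. Qed.

Lemma mxdotNr A X : mxdot X (- A) = - mxdot X A.
Proof. by rewrite mxdotC mxdotNl mxdotC. Qed.

Lemma mxdotBl A B X : mxdot (A - B) X = mxdot A X - mxdot B X.
Proof. by rewrite mxdotDl mxdotNl. Qed.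

Lemma mxdotBr A B X : mxdot X (A - B) = mxdot X A - mxdot X B.
Proof. by rewrite mxdotDr mxdotNr. Qed.

Lemma mxdot0l X : mxdot 0 X = 0.
Proof. by rewrite -(scale0r X) mxdotZl mul0r. Qed.

Lemma mxdot0r X : mxdot X 0 = 0.
Proof. by rewrite mxdotC mxdot0l. Qed.

Lemma mxdot_suml (J : Type) (r : seq J) (F : J -> 'M[R]_(m, p)) X :
  mxdot (\sum_(k <- r) F k) X = \sum_(k <- r) mxdot (F k) X.
Proof.
by elim: r => [|k r IH]; rewrite ?big_nil ?mxdot0l // !big_cons mxdotDl IH.
Qed.

Lemma mxdot_delta A i j : mxdot A (delta_mx i j) = A i j.
Proof.
rewrite /mxdot (bigD1 i) //= (bigD1 j) //= mxE !eqxx mulr1 !big1 ?addr0 //.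
  by move=> k ki; apply: big1 => l _; rewrite mxE (negPf ki) mulr0.
by move=> l lj; rewrite mxE (negPf lj) andbF mulr0.
Qed.

Lemma mxdot_row A B : mxdot A B = \sum_i mxdot (row i A) (row i B).
Proof.
apply: eq_bigr => i _; rewrite /mxdot big_ord1.
by apply: eq_bigr => j _; rewrite !mxE.
Qed.

Lemma mxdot_ge0 A : 0 <= mxdot A A.
Proof. by apply: sumr_ge0 => i _; apply: sumr_ge0 => j _; rewrite -expr2 sqr_ge0. Qed.

Lemma mxdot_eq0 A : mxdot A A = 0 -> A = 0.
Proof.
move/psumr_eq0P => H; apply/matrixP => i j; rewrite mxE; apply/eqP.
rewrite -sqrf_eq0 expr2; apply/eqP.
apply: (psumr_eq0P _ (H _ i isT)) => // [k _|k _]; first by rewrite -expr2 sqr_ge0.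
by apply: sumr_ge0 => l _; rewrite -expr2 sqr_ge0.
Qed.

Lemma enorm_ge0 A : 0 <= enorm A.
Proof. exact: sqrtr_ge0. Qed.

Lemma enorm_sqr A : enorm A ^+ 2 = mxdot A A.
Proof. by rewrite sqr_sqrtr // mxdot_ge0. Qed.

Lemma enorm_eq0 A : enorm A = 0 -> A = 0.
Proof. by move=> A0; apply: mxdot_eq0; rewrite -enorm_sqr A0 expr0n. Qed.

Lemma cauchy_schwarz A B : mxdot A B <= enorm A * enorm B.
Proof.
have [/enorm_eq0 ->|A0] := eqVneq (enorm A) 0.
  by rewrite mxdot0l mulr_ge0 ?enorm_ge0.
have [/enorm_eq0 ->|B0] := eqVneq (enorm B) 0.
  by rewrite mxdot0r mulr_ge0 ?enorm_ge0.
have {}A0 : 0 < enorm A by rewrite lt_def A0 enorm_ge0.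
have {}B0 : 0 < enorm B by rewrite lt_def B0 enorm_ge0.
have := mxdot_ge0 (enorm B *: A - enorm A *: B).
rewrite mxdotBl !mxdotBr !mxdotZl !mxdotZr -!enorm_sqr (mxdotC B A) => H.
rewrite -(@ler_pM2l _ (2 * (enorm A * enorm B))); last by rewrite !mulr_gt0.
by nra.
Qed.

Lemma enormZ a A : enorm (a *: A) = `|a| * enorm A.
Proof.
by rewrite /enorm mxdotZl mxdotZr mulrA -expr2 sqrtrM ?sqr_ge0 // sqrtr_sqr.
Qed.

End Dot.

(** * Subgradients and the Hahn-Banach argument *)

Definition convexf {R : realType} {V : lmodType R} (f : V -> R) : Prop :=
  forall (t : R) (x y : V), 0 <= t -> t <= 1 ->
    f (t *: x + (1 - t) *: y) <= t * f x + (1 - t) * f y.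

(** One-dimensional Hahn-Banach step: the zero functional on [L], which lies below [f], is extended
    along [e] with slope [a]. Negative [t] bounds [a] from below and positive [t] from above;
    convexity of [f] makes every lower bound at most every upper bound. *)
Lemma convex_extend1 {R : realType} {V : lmodType R} (f : V -> R)
    (L : set V) (e : V) :
  convexf f -> L 0 ->
  (forall (t : R) y z, L y -> L z -> L (t *: y + (1 - t) *: z)) ->
  (forall y, L y -> 0 <= f y) ->
  exists a : R, forall y (t : R), L y -> a * t <= f (y + t *: e).
Proof.
move=> cf L0 Lc Lf.
have key y z (t s : R) : L y -> L z -> 0 < t -> 0 < s ->
    - f (z - s *: e) / s <= f (y + t *: e) / t.
  move=> Ly Lz t0 s0.
  have st0 : 0 < s + t by rewrite addr_gt0.
  (* This weight makes [q * t = (1 - q) * s], so [e] cancels in the convex combination and the point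
     falls in [L], where [f] is nonnegative. *)
  pose q := s / (s + t).
  have q1 : 1 - q = t / (s + t) by rewrite /q; field; rewrite gt_eqF.
  have := Lf _ (Lc q _ _ Ly Lz).
  have -> : q *: y + (1 - q) *: z =
      q *: (y + t *: e) + (1 - q) *: (z - s *: e).
    rewrite !scalerDr scalerN !scalerA q1 /q addrACA -addrA.
    by rewrite (_ : s / _ * t = t / (s + t) * s) ?subrr ?addr0 ?addrA //; ring.
  move=> H; have {}H : 0 <= q * f (y + t *: e) + (1 - q) * f (z - s *: e).
    apply: (le_trans H); apply: cf; first by rewrite divr_ge0 ?ltW.
    by rewrite ler_pdivrMr // mul1r lerDl ltW.
  have {}H : 0 <= s * f (y + t *: e) + t * f (z - s *: e).
    rewrite -(@pmulr_rge0 _ (s + t)^-1) ?invr_gt0 //.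
    by move: H; rewrite q1 /q; congr (0 <= _); ring.
  by rewrite ler_pdivrMr // mulrAC ler_pdivlMr //; lra.
(* All lower bounds on the slope; their supremum is the slope chosen. *)
pose S := [set - f (zs.1 - zs.2 *: e) / zs.2 | zs in [set zs : V * R | L zs.1 /\ 0 < zs.2]].
have S0 : S !=set0 by exists (- f (0 - 1 *: e) / 1); exists (0, 1).
have Sub y t : L y -> 0 < t -> ubound S (f (y + t *: e) / t).
  by move=> Ly t0 _ [[z s] /= [Lz s0] <-]; apply: key.
have Ssup : has_sup S.
  by split=> //; exists (f (0 + 1 *: e) / 1); apply: Sub.
exists (sup S) => y t Ly; have [t0|t0|->] := ltgtP t 0.
- rewrite -(opprK t) mulrN lerNl scaleNr.
  have nt0 : 0 < - t by rewrite oppr_gt0.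
  rewrite -ler_pdivrMr //; apply: ub_le_sup => //; first by case: Ssup.
  by exists (y, - t).
- rewrite -ler_pdivlMr //; apply: ge_sup => //; exact: Sub.
- by rewrite mulr0 scale0r addr0; exact: Lf.
Qed.

(** Finite-dimensional Hahn-Banach, where the subspace consists of the matrices supported on [A].
    The induction is on the number of coordinates outside [A]: each step adds one coordinate to [A]
    and subtracts from [f] the linear term just found, which is put back into [G] at the end. *)
Lemma convex_extend {R : realType} {m p : nat} (f : 'M[R]_(m, p) -> R)
    (A : {set 'I_m * 'I_p}) :
  convexf f ->
  (forall T : 'M[R]_(m, p), (forall ij, ij \notin A -> T ij.1 ij.2 = 0) -> 0 <= f T) ->
  exists G : 'M[R]_(m, p), (forall ij, ij \in A -> G ij.1 ij.2 = 0) /\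
    forall T, mxdot G T <= f T.
Proof.
move: {2}#|~: A| (leqnn #|~: A|) => k; elim: k f A => [|k IH] f A.
  rewrite leqn0 cards_eq0 => /eqP A0 cf fA; exists 0; split=> [ij _|T].
    by rewrite mxE.
  rewrite mxdot0l; apply: fA => ij; rewrite -finset.in_setC A0 finset.in_set0 //.
move=> kA cf fA; have [A0|[[i j] ijA]] := set_0Vmem (~: A).
  by apply: IH => //; rewrite A0 cards0.
pose L := [set T : 'M[R]_(m, p) | forall ij, ij \notin A -> T ij.1 ij.2 = 0].
have [|||a aP] := @convex_extend1 _ _ f L (delta_mx i j) cf.
- by move=> ij _; rewrite mxE.
- by move=> t y z Ly Lz ij ijN; rewrite !mxE Ly // Lz // !mulr0 addr0.
- by move=> y; exact: fA.
have [|||G [G0 Gf]] := IH (fun T => f T - a * T i j) ((i, j) |: A).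
- rewrite finset.setCU -ltnS; apply: leq_trans kA; apply: proper_card.
  apply/properP; split; first exact: finset.subsetIr.
  by exists (i, j) => //; rewrite !inE eqxx.
- by move=> t x y t0 t1; have := cf t x y t0 t1; rewrite !mxE; lra.
- move=> T TA; rewrite subr_ge0.
  (* Removing the entry at [(i, j)] leaves a matrix supported on [A], so the one-dimensional step
     applies with [t = T i j]. *)
  rewrite -{2}(subrK (T i j *: delta_mx i j) T); apply: aP => -[k' l] klA.
  rewrite !mxE /=; have [[-> ->]|kl] := eqVneq (k', l) (i, j).
    by rewrite !eqxx mulr1 subrr.
  rewrite -xpair_eqE (negPf kl) mulr0 subr0; apply: (TA (k', l)).
  by rewrite finset.in_setU1 negb_or kl.
exists (G + a *: delta_mx i j); split=> [[k' l] klA|T].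
  rewrite !mxE (G0 (k', l)) ?finset.in_setU1 ?klA ?orbT //= -xpair_eqE.
  have -> : (k', l) == (i, j) = false.
    by apply: contraTF klA => /eqP ->; rewrite inE in ijA.
  by rewrite mulr0 addr0.
rewrite mxdotDl mxdotZl (mxdotC (delta_mx i j)) mxdot_delta.
by have := Gf T; lra.
Qed.

Section Norm.
Context {R : realType} {s : nat} {nu : 'rV[R]_s -> R} (hnu : is_norm nu).

Lemma norm_convex : convexf nu.
Proof.
have [nuD nuZ _] := hnu; move=> t x y t0 t1.
by apply: le_trans (nuD _ _) _; rewrite !nuZ !ger0_norm // subr_ge0.
Qed.

Lemma norm_subdiff_ex v : exists g, subdiff (fun v => (nu v)%:E) v g.
Proof.
have [|T T0|G [_ Gf]] := @convex_extend _ _ _ (fun T => nu (v + T) - nu v)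
  finset.set0.
- move=> t x y t0 t1.
  have -> : v + (t *: x + (1 - t) *: y) = t *: (v + x) + (1 - t) *: (v + y).
    by rewrite !scalerDr addrACA -scalerDl subrKC scale1r.
  by have := norm_convex t (v + x) (v + y) t0 t1; lra.
- have -> : T = 0.
    by apply/matrixP => i j; rewrite mxE; apply: (T0 (i, j)); rewrite finset.inE.
  by rewrite addr0 subrr.
exists G => y /=; rewrite -EFinD lee_fin.
by have := Gf (y - v); rewrite subrKC; lra.
Qed.

(* Moreau-Rockafellar: the perturbed sum \sum_x w_x nu (I_x - c - h_x) of all
   the (c, h) is convex and minimal on h = 0; a linear functional that separates
   it from this subspace is a family of subgradients, and their sum is 0 because
   the perturbed sum is invariant along h_x = - c. *)
Lemma minimizer_c_stationary {n : nat} (I : 'M[R]_(n, s)) (w : 'cV[R]_n)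
    (c : 'rV[R]_s) :
  (forall x, 0 <= w x 0) -> is_minimizer (fitting nu I w) c ->
  c_stationary nu I w c.
Proof.
move=> w0 cmin; pose v x := row x I - c.
(* The top row of [T] is the displacement of [c]; the [n] rows below are the perturbations [h_x]. *)
pose pt (T : 'M[R]_(1 + n, s)) x := v x - usubmx T - row x (dsubmx T).
pose f T := \sum_x (nu (pt T x) - nu (v x)) * w x 0.
have cf : convexf f.
  move=> t x y t0 t1; rewrite /f !mulr_sumr -big_split; apply: ler_sum => k _ /=.
  rewrite !mulrA -mulrDl; apply: ler_wpM2r => //.
  have -> : pt (t *: x + (1 - t) *: y) k = t *: pt x k + (1 - t) *: pt y k.
    by apply/rowP => j; rewrite !mxE; ring.
  by have := norm_convex t (pt x k) (pt y k) t0 t1; lra.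
pose A := [set ij : 'I_(1 + n) * 'I_s | (0 < ij.1)%N]%SET.
have f0 (T : 'M[R]_(1 + n, s)) : (forall ij, ij \notin ~: A -> T ij.1 ij.2 = 0) -> 0 <= f T.
  move=> TA; rewrite /f.
  under eq_bigr do rewrite mulrBl.
  rewrite sumrB subr_ge0; apply: (le_trans (cmin (c + usubmx T))).
  apply: ler_sum => x _; apply: ler_wpM2r => //.
  rewrite /pt (_ : row x (dsubmx T) = 0) ?subr0 /v ?opprD ?addrA //.
  by apply/rowP => j; rewrite !mxE; apply: (TA (_, j)); rewrite !finset.inE.
(* The complement of [A] is the top row: [f] is nonnegative when only [c] moves, and [G] vanishes on
   that row. *)
have [G [G0 Gf]] := convex_extend f (~: A)%SET cf f0.
pose F x := row x (dsubmx G).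
have GE T : mxdot G T = \sum_x mxdot (F x) (row x (dsubmx T)).
  rewrite mxdot_row big_split_ord big_ord1 /=.
  rewrite (_ : row _ G = 0) ?mxdot0l ?add0r.
    by apply: eq_bigr => x _; congr mxdot; apply/rowP => j; rewrite !mxE.
  by apply/rowP => j; rewrite !mxE; apply: (G0 (_, j)); rewrite !finset.inE.
have Fsum : \sum_x F x = 0.
  apply: mxdot_eq0; apply/le_anti; rewrite mxdot_ge0 andbT.
  set S := \sum_x F x.
  (* In this direction the displacements cancel, so [f] is 0 while [G] gives the squared norm of
     [S]. *)
  have := Gf (col_mx (- S) (\matrix_(x, j) S 0 j)); rewrite GE.
  under eq_bigr do rewrite col_mxKd.
  have rS x : row x (\matrix_(x, j) S 0 j : 'M[R]_(n, s)) = S.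
    by apply/rowP => j; rewrite !mxE.
  under eq_bigr do rewrite rS.
  rewrite -mxdot_suml.
  rewrite -/S /f big1; first by [].
  by move=> x _; rewrite /pt col_mxKu col_mxKd rS opprK addrK subrr mul0r.
have Fle x h : mxdot (F x) h <= (nu (v x - h) - nu (v x)) * w x 0.
  pose H : 'M[R]_(n, s) := \matrix_(y, j) if y == x then h 0 j else 0.
  have rH y : row y H = if y == x then h else 0.
    by apply/rowP => j; rewrite !mxE; case: ifP; rewrite ?mxE.
  have := Gf (col_mx 0 H); rewrite GE /f /pt.
  rewrite (bigD1 x) //= [leRHS](bigD1 x) //= !col_mxKd !col_mxKu subr0 !rH eqxx.
  rewrite [X in _ + X]big1 ?[X in _ <= _ + X]big1 ?addr0 // => y yx.
    by rewrite rH (negPf yx) !subr0 subrr mul0r.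
  by rewrite rH (negPf yx) mxdot0r.
have ex x : exists g, subdiff (fun v => (nu v)%:E) (v x) g /\ w x 0 *: g = - F x.
  (* At zero weight [Fle] forces [F x = 0], so any subgradient will do; otherwise [F x] is divided
     by the weight, with a sign change because [h] enters [pt] negatively. *)
  have [wx|wx] := eqVneq (w x 0) 0.
    have [g hg] := norm_subdiff_ex (v x); exists g; split => //.
    rewrite wx scale0r; apply/esym/eqP; rewrite oppr_eq0; apply/eqP/mxdot_eq0.
    apply/le_anti; rewrite mxdot_ge0 andbT.
    by have := Fle x (F x); rewrite wx mulr0.
  exists (- (w x 0)^-1 *: F x); split; last by rewrite scalerA mulrN divff // scaleN1r.
  have {}wx : 0 < w x 0 by rewrite lt_def wx w0.
  move=> y /=; rewrite -EFinD lee_fin mxdotZl mulNr -mulrN -mxdotNr opprB.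
  have := Fle x (v x - y); rewrite subKr -ler_pdivrMr // mulrC; lra.
have [g hg] := choice ex.
exists g; split=> [x|]; first by case: (hg x).
under eq_bigr do rewrite (hg _).2.
by rewrite sumrN Fsum oppr0.
Qed.

End Norm.

(** * Optimality conditions of one step *)

Lemma enorm_is_norm {R : realType} {s : nat} : is_norm (@enorm R 1 s).
Proof.
split=> [v w|a v|v]; [|exact: enormZ|exact: enorm_eq0].
rewrite -(@ler_pXn2r _ 2) ?nnegrE ?addr_ge0 ?enorm_ge0 //.
rewrite sqrrD !enorm_sqr mxdotDl !mxdotDr (mxdotC w v).
by have := cauchy_schwarz v w; lra.
Qed.

(** Shrinkage is the proximal map of the Euclidean norm, so the scaled displacement [r *: (v - d)]
    is a subgradient at [d]. It is [r *: v], of norm at most 1, when [d = 0], and the unit vector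
    along [v] otherwise. *)
Lemma shrink_subgrad {R : realType} (r : R) (v y : 'rV[R]_2) : 0 < r ->
  let d := shrink v r^-1 in
  enorm d + mxdot (r *: (v - d)) (y - d) <= enorm y.
Proof.
move=> r0; rewrite /shrink /=.
have CS := cauchy_schwarz v y; have v0 := enorm_ge0 v; have y0 := enorm_ge0 y.
have [vr|vr] := leP (enorm v - r^-1) 0.
  rewrite mul0r scale0r !subr0 /enorm mxdot0l sqrtr0 add0r -!/(enorm _) mxdotZl.
  apply: (@le_trans _ _ (r * (enorm v * enorm y))); first by rewrite ler_pM2l.
  rewrite mulrA ler_piMl // -(@ler_pM2l _ r^-1) ?invr_gt0 //.
  by rewrite mulKf ?gt_eqF // mulr1; lra.
have {}v0 : 0 < enorm v.
  by move: r0; rewrite -invr_gt0; lra.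
set q := _ / _; have qv : q * enorm v = enorm v - r^-1.
  by rewrite /q divfK ?gt_eqF.
have q0 : 0 < q by rewrite divr_gt0.
(* This says that [r *: (v - d)] has norm 1. *)
have rq : r * (1 - q) * enorm v = 1.
  by rewrite -mulrA mulrBl qv mul1r opprB addrC subrK divff ?gt_eqF.
have -> : v - q *: v = (1 - q) *: v by rewrite scalerBl scale1r.
rewrite scalerA mxdotZl mxdotBr mxdotZr -enorm_sqr.
rewrite enormZ gtr0_norm // mulrBr.
have -> : r * (1 - q) * (q * enorm v ^+ 2) = q * enorm v.
  by rewrite expr2 -[RHS]mulr1 -[X in _ = _ * X]rq; ring.
rewrite subrKC; have rq0 : 0 <= r * (1 - q).
  by rewrite -(@pmulr_lge0 _ (enorm v)) // rq.
apply: (le_trans (ler_wpM2l rq0 CS)).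
by rewrite mulrA rq mul1r.
Qed.

(** Testing at [d + g] and using the triangle inequality bounds the squared norm of [g] by its
    norm. *)
Lemma subgrad_enorm_le1 {R : realType} {s : nat} (d g : 'rV[R]_s) :
  (forall v, enorm d + mxdot g (v - d) <= enorm v) -> enorm g <= 1.
Proof.
move=> /(_ (d + g)); rewrite [d + g - d]addrAC subrr add0r -enorm_sqr => H.
have [g0|g0] := eqVneq (enorm g) 0; first by rewrite g0.
have {}g0 : 0 < enorm g by rewrite lt_def g0 enorm_ge0.
rewrite -(@ler_pM2l _ (enorm g)) // mulr1 -expr2.
by have [/(_ d g)] := @enorm_is_norm R s; lra.
Qed.

Lemma proj_variational {R : realType} {m p : nat} (A : set 'M[R]_(m, p)) X P :
  (forall (t : R) Y Z, 0 <= t -> t <= 1 -> A Y -> A Z ->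
     A (t *: Y + (1 - t) *: Z)) ->
  is_proj A X P -> forall Q, A Q -> mxdot (X - P) (Q - P) <= 0.
Proof.
move=> Ac [AP Pmin] Q AQ.
have key (t : R) : 0 < t -> t <= 1 ->
    2 * mxdot (X - P) (Q - P) <= t * mxdot (Q - P) (Q - P).
  move=> t0 t1; have := Pmin _ (Ac _ _ _ (ltW t0) t1 AQ AP).
  have -> : X - (t *: Q + (1 - t) *: P) = (X - P) - t *: (Q - P).
    by apply/matrixP => i j; rewrite !mxE; ring.
  rewrite -(@ler_pXn2r _ 2) ?nnegrE ?enorm_ge0 // !enorm_sqr.
  rewrite [X in _ <= X]mxdotBl !(mxdotBr (X - P)) !mxdotZl !mxdotZr.
  rewrite (mxdotC (Q - P) (X - P)) => H.
  by rewrite -(@ler_pM2l _ t) //; nra.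
set a := mxdot (X - P) _ in key *; set b := mxdot (Q - P) _ in key.
have b0 : 0 <= b := mxdot_ge0 _.
rewrite leNgt; apply/negP => a0.
(* An explicit small step replaces the limit [t -> 0]: if [a > 0], it gives [2 * (a + b) <= b],
   which is absurd. *)
have := key (a / (a + b)); rewrite divr_gt0 ?ltr_wpDr // ler_pdivrMr ?ltr_wpDr //.
rewrite mul1r lerDl b0 => /(_ isT isT).
by rewrite mulrAC ler_pdivlMr ?ltr_wpDr //; nra.
Qed.

Lemma simplex_convex {R : realType} {n N : nat} (t : R) (Y Z : 'M[R]_(n, N)) :
  0 <= t -> t <= 1 -> simplex Y -> simplex Z -> simplex (t *: Y + (1 - t) *: Z).
Proof.
move=> t0 t1 YS ZS x; have [Y0 Y1] := YS x; have [Z0 Z1] := ZS x; split=> [i|].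
  by rewrite !mxE addr_ge0 // mulr_ge0 // subr_ge0.
under eq_bigr do rewrite !mxE.
by rewrite big_split -!mulr_sumr /= Y1 Z1 !mulr1 subrKC.
Qed.

Lemma mxdot_mxvec {R : realType} {m p : nat} (A B : 'M[R]_(m, p)) :
  mxdot A B = (mxvec A *m (mxvec B)^T) 0 0.
Proof.
rewrite /mxdot pair_bigA mxE /=.
rewrite (reindex _ (curry_mxvec_bij m p)) /=.
by apply: eq_bigr => -[i j] _; rewrite mxE !mxvecE.
Qed.

Lemma eq_col {T : Type} {m p : nat} (A B : 'M[T]_(m, p)) :
  (forall i, col i A = col i B) -> A = B.
Proof.
move=> AB; apply/matrixP => x i.
by have := congr1 (fun v : 'cV_m => v x 0) (AB i); rewrite !mxE.
Qed.

(** * The adjoint of the gradient and the operator of the U-step *)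

Section Gradient.
Context {R : realType} {n : nat} (grad : {linear 'cV[R]_n -> 'M[R]_(n, 2)}).

Lemma gradT_adjoint p u : mxdot (gradT grad p) u = mxdot p (grad u).
Proof.
by rewrite !mxdot_mxvec vec_mxK -mul_vec_lin trmx_mul mulmxA.
Qed.

Lemma gradT_linear : linear (gradT grad).
Proof. by move=> a p q; rewrite /gradT linearP mulmxDl -scalemxAl linearP. Qed.

HB.instance Definition _ :=
  GRing.isLinear.Build R 'M[R]_(n, 2) 'cV[R]_n *:%R (gradT grad) gradT_linear.

(** Named so that a linear structure can be attached to it. *)
Definition gradTgradD1 u := gradT grad (grad u) + u.

Lemma gradTgradD1_linear : linear gradTgradD1.
Proof. by move=> a u v; rewrite /gradTgradD1 !linearP scalerDr addrACA. Qed.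

HB.instance Definition _ :=
  GRing.isLinear.Build R 'cV[R]_n 'cV[R]_n *:%R gradTgradD1 gradTgradD1_linear.

(** The kernel is trivial: pairing the image of [u] with [u] gives the sum of the squared norms of
    [grad u] and [u]. *)
Lemma gradTgradD1_unit : lin_mx gradTgradD1 \in unitmx.
Proof.
rewrite -row_free_unit -kermx_eq0; apply/eqP/row_matrixP => i; rewrite row0.
set v := row i _; have : v *m lin_mx gradTgradD1 = 0.
  by apply/sub_kermxP/row_sub.
rewrite -(vec_mxK v) mul_vec_lin => /(congr1 vec_mx); rewrite mxvecK linear0 => u0.
set u := vec_mx v in u0 *; suff -> : u = 0 by rewrite linear0.
apply: mxdot_eq0; apply/le_anti; rewrite mxdot_ge0 andbT.
have := congr1 (fun w => mxdot w u) u0; rewrite mxdotDl gradT_adjoint mxdot0l.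
by have := mxdot_ge0 (grad u); lra.
Qed.

Lemma opinvK b : gradTgradD1 (opinv gradTgradD1 b) = b.
Proof.
apply: (can_inj mxvecK).
by rewrite -mul_vec_lin vec_mxK mulmxKV // gradTgradD1_unit.
Qed.

Context {N : nat}.

Lemma gradTn_col (L : 'M['rV[R]_2]_(n, N)) i :
  col i (gradTn grad L) = gradT grad (vcol i L).
Proof. by apply/colP => x; rewrite !mxE. Qed.

Lemma gradTgradD1_solven (B : 'M[R]_(n, N)) i :
  gradTgradD1 (col i (solven grad B)) = col i B.
Proof.
rewrite -[RHS]opinvK; congr gradTgradD1.
by apply/colP => x; rewrite !mxE.
Qed.

Lemma gradnB (U V : 'M[R]_(n, N)) x i :
  gradn grad (U - V) x i = gradn grad U x i - gradn grad V x i.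
Proof.
by rewrite !mxE -!linearB; congr (row x (grad _)); apply/colP => y; rewrite !mxE.
Qed.

Lemma gradTn_adjoint (L : 'M['rV[R]_2]_(n, N)) V :
  \sum_i \sum_x mxdot (L x i) (gradn grad V x i) = mxdot (gradTn grad L) V.
Proof.
have -> : mxdot (gradTn grad L) V =
    \sum_i mxdot (col i (gradTn grad L)) (col i V).
  rewrite /mxdot exchange_big; apply: eq_bigr => i _; apply: eq_bigr => x _ /=.
  by rewrite big_ord1 !mxE.
apply: eq_bigr => i _; rewrite gradTn_col gradT_adjoint mxdot_row.
apply: eq_bigr => x _; congr mxdot; last by rewrite mxE.
by apply/rowP => j; rewrite !mxE.
Qed.

End Gradient.

(* First-order optimality of the three minimization steps that produce D', W'
   and C' from (C, U, LD, LW), and of the previous U-step. *)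
Definition step_optimal {R : realType} {n N s : nat} (nu : 'rV[R]_s -> R)
    (I : 'M[R]_(n, s)) (lam r : R)
    (grad : {linear 'cV[R]_n -> 'M[R]_(n, 2)})
    (D' : 'M['rV[R]_2]_(n, N)) (W' : 'M[R]_(n, N)) (C C' : 'M[R]_(N, s))
    (U : 'M[R]_(n, N)) (LD : 'M['rV[R]_2]_(n, N)) (LW : 'M[R]_(n, N)) : Prop :=
  [/\ forall x i v,
        enorm (D' x i) +
          mxdot (LD x i + r *: (gradn grad U x i - D' x i)) (v - D' x i)
        <= enorm v,
      simplex W' /\ forall V, simplex V ->
        mxdot (LW + r *: (U - W') - lam *: absdiff nu I C) (V - W') <= 0,
      forall i, is_minimizer (fitting nu I (col i W')) (row i C')
    & gradTn grad LD + LW = 0].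

Lemma L1FS_step_optimal {R : realType} {n N s : nat} {nu : 'rV[R]_s -> R}
    {I : 'M[R]_(n, s)} {lam r : R} {grad : {linear 'cV[R]_n -> 'M[R]_(n, 2)}}
    {D : nat -> 'M['rV[R]_2]_(n, N)} {W : nat -> 'M[R]_(n, N)}
    {C : nat -> 'M[R]_(N, s)} {U : nat -> 'M[R]_(n, N)}
    {LD : nat -> 'M['rV[R]_2]_(n, N)} {LW : nat -> 'M[R]_(n, N)} (k : nat) :
  0 < r -> is_L1FS nu I lam r grad D W C U LD LW ->
  step_optimal nu I lam r grad (D k.+1) (W k.+1) (C k) (C k.+1) (U k) (LD k) (LW k).
Proof.
move=> r0 [LD0 LW0 alg]; have rn0 : r != 0 by rewrite gt_eqF.
have [hD hW [_ hC] _ _] := alg k; split.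
- move=> x i v; rewrite hD.
  set y := gradn grad (U k) x i + _.
  have -> : LD k x i + r *: (gradn grad (U k) x i - shrink y r^-1) =
      r *: (y - shrink y r^-1).
    by move: (shrink y _) => d; rewrite /y !scalerBr scalerDr scalerA divff // scale1r addrAC addrC.
  exact: shrink_subgrad.
- split; first by case: hW.
  move=> V VS; have := proj_variational _ _ _ simplex_convex hW _ VS.
  rewrite -(@pmulr_rle0 _ r) // -mxdotZl.
  congr (mxdot _ _ <= 0); apply/matrixP => x i; rewrite !mxE.
  by field.
- by move=> i; case: (hC i).
(* At index 0 both multipliers are zero. Later, substituting the multiplier updates turns the claim
   into [r] times the linear system for [U k.+1]. *)
- case: k => [|k] in hD hW hC *.
    rewrite LD0 LW0 addr0; apply: eq_col => i; rewrite gradTn_col.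
    by rewrite (_ : vcol i 0 = 0) ?linear0 //; apply/matrixP => y j; rewrite !mxE.
  have [_ _ _ hU [hLD hLW]] := alg k.
  apply: eq_col => i; rewrite linearD /= gradTn_col linear0 hLW /=.
  have vcolE : vcol i (LD k.+1) =
      vcol i (LD k) + r *: (grad (col i (U k.+1)) - vcol i (D k.+1)).
    by apply/matrixP => x j; rewrite mxE hLD !mxE.
  have colE : gradT grad (grad (col i (U k.+1))) + col i (U k.+1) =
      gradT grad (vcol i (D k.+1)) + col i (W k.+1)
      - r^-1 *: gradT grad (vcol i (LD k)) - r^-1 *: col i (LW k).
    rewrite [LHS](_ : _ = gradTgradD1 grad (col i (U k.+1))) // {1}hU.
    by rewrite gradTgradD1_solven !linearB linearD !linearZ /= !gradTn_col.
  rewrite vcolE !linearD !linearZ /= !linearN /=.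
  move: (gradT grad (vcol i (LD k))) (gradT grad (vcol i (D k.+1))) colE => a b.
  move: (gradT grad _) => c colE; apply/colP => x.
  have := congr1 (fun u : 'cV_n => u x 0) colE; rewrite !mxE => /eqP.
  rewrite -subr_eq0 => /eqP E; apply: (@mulfI _ r^-1); first by rewrite invr_eq0.
  by rewrite mulr0 -[RHS]E; field.
Qed.

(** * Passage to the limit *)

(** Entrywise convergence reduces every limit to limits of real sequences; [cvg_mxcvg] derives it
    from the product topology. *)
Definition mxcvg {R : realType} {m p : nat} (X : nat -> 'M[R]_(m, p))
    (A : 'M[R]_(m, p)) : Prop :=
  forall i j, X k i j @[k --> \oo] --> A i j.

Definition vcvg {R : realType} {n N : nat} (X : nat -> 'M['rV[R]_2]_(n, N))
    (A : 'M['rV[R]_2]_(n, N)) : Prop :=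
  forall x i, mxcvg (fun k => X k x i) (A x i).

Lemma cvg_sumr {R : realType} {J : Type} (r : seq J) (f : J -> nat -> R) (l : J -> R) :
  (forall i, f i k @[k --> \oo] --> l i) ->
  \sum_(i <- r) f i k @[k --> \oo] --> \sum_(i <- r) l i.
Proof. by move=> fl; apply: cvg_big => [|i _]; [exact: add_continuous|exact: fl]. Qed.

Section Entrywise.
Context {R : realType}.

Section Matrix.
Context {m p : nat}.
Implicit Types (X Y : nat -> 'M[R]_(m, p)) (A B : 'M[R]_(m, p)).

Lemma mxcvg_cst A : mxcvg (fun=> A) A.
Proof. by move=> i j; exact: cvg_cst. Qed.

Lemma mxcvgD {X Y A B} : mxcvg X A -> mxcvg Y B -> mxcvg (fun k => X k + Y k) (A + B).
Proof.
move=> XA YB i j; rewrite mxE; under eq_fun do rewrite mxE.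
exact: cvgD (XA i j) (YB i j).
Qed.

Lemma mxcvgZ a {X A} : mxcvg X A -> mxcvg (fun k => a *: X k) (a *: A).
Proof.
move=> XA i j; rewrite mxE; under eq_fun do rewrite mxE.
by apply: cvgM (XA i j); exact: cvg_cst.
Qed.

Lemma mxcvgN {X A} : mxcvg X A -> mxcvg (fun k => - X k) (- A).
Proof.
by move=> /(mxcvgZ (-1)); rewrite scaleN1r; under eq_fun do rewrite scaleN1r.
Qed.

Lemma mxcvgB {X Y A B} : mxcvg X A -> mxcvg Y B -> mxcvg (fun k => X k - Y k) (A - B).
Proof. by move=> XA /mxcvgN; exact: mxcvgD. Qed.

Lemma mxcvg_unique {X A B} : mxcvg X A -> mxcvg X B -> A = B.
Proof.
move=> XA XB; apply/matrixP => i j.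
by apply: cvg_unique (XA i j) (XB i j); exact: Rhausdorff.
Qed.

Lemma cvg_mxdot {X Y A B} : mxcvg X A -> mxcvg Y B ->
  mxdot (X k) (Y k) @[k --> \oo] --> mxdot A B.
Proof.
move=> XA YB; apply: cvg_sumr => i; apply: cvg_sumr => j.
exact: cvgM (XA i j) (YB i j).
Qed.

End Matrix.

Lemma mxcvg_row {m p : nat} {X : nat -> 'M[R]_(m, p)} {A} i :
  mxcvg X A -> mxcvg (fun k => row i (X k)) (row i A).
Proof. by move=> XA j l; rewrite mxE; under eq_fun do rewrite mxE; exact: XA. Qed.

Lemma mxcvg_col {m p : nat} {X : nat -> 'M[R]_(m, p)} {A} i :
  mxcvg X A -> mxcvg (fun k => col i (X k)) (col i A).
Proof. by move=> XA j l; rewrite mxE; under eq_fun do rewrite mxE; exact: XA. Qed.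

Lemma cvg_norm_entrywise {s : nat} {nu : 'rV[R]_s -> R} (hnu : is_norm nu)
    {X : nat -> 'rV[R]_s} {A} :
  mxcvg X A -> nu (X k) @[k --> \oo] --> nu A.
Proof.
have [nuD nuZ _] := hnu; move=> XA.
have nu0 : nu 0 = 0 by rewrite -(scale0r 0) nuZ normr0 mul0r.
(* An arbitrary norm is dominated by a weighted l1 norm, which makes it continuous for entrywise
   convergence. *)
have nule v : nu v <= \sum_j `|v 0 j| * nu (delta_mx 0 j).
  rewrite {1}(row_sum_delta v); elim/big_rec2: _ => [|j y z _ yz]; first by rewrite nu0.
  by apply: le_trans (nuD _ _) _; rewrite nuZ lerD2l.
have nuN v : nu (- v) = nu v by rewrite -scaleN1r nuZ normrN1 mul1r.
pose e k := \sum_j `|(X k - A) 0 j| * nu (delta_mx 0 j).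
have e0 : e k @[k --> \oo] --> (0 : R).
  have -> : 0 = \sum_j `|(0 : 'rV[R]_s) 0 j| * nu (delta_mx 0 j) :> R.
    by rewrite big1 // => j _; rewrite mxE normr0 mul0r.
  apply: cvg_sumr => j; apply: cvgM; last exact: cvg_cst.
  by apply: cvg_norm; rewrite -(subrr A); exact: mxcvgB XA (mxcvg_cst A) 0 j.
apply: (@squeeze_cvgr _ _ _ _ (fun k => nu A - e k) (fun k => nu A + e k)).
- apply: nearW => k; have := nule (X k - A); rewrite -/(e k) => h.
  have := nuD (X k - A) A; have := nuD (A - X k) (X k); rewrite !subrK.
  by rewrite -(nuN (A - _)) opprB => h1 h2; apply/andP; split; lra.
- by rewrite -[X in _ --> X]subr0; apply: cvgB => //; exact: cvg_cst.
- by rewrite -[X in _ --> X]addr0; apply: cvgD => //; exact: cvg_cst.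
Qed.

Lemma cvg_enorm {s : nat} (X : nat -> 'rV[R]_s) {A} :
  mxcvg X A -> enorm (X k) @[k --> \oo] --> enorm A.
Proof. exact: (cvg_norm_entrywise enorm_is_norm). Qed.

Lemma mxcvg_absdiff {n N s : nat} (nu : 'rV[R]_s -> R) (hnu : is_norm nu)
    (I : 'M[R]_(n, s)) (C : nat -> 'M[R]_(N, s)) Cs :
  mxcvg C Cs -> mxcvg (fun k => absdiff nu I (C k)) (absdiff nu I Cs).
Proof.
move=> CC x i; rewrite mxE; under eq_fun do rewrite mxE.
apply: cvg_norm_entrywise => //; apply: mxcvgB; first exact: mxcvg_cst.
exact: mxcvg_row.
Qed.

Lemma vcvg_gradn {n N : nat} (grad : {linear 'cV[R]_n -> 'M[R]_(n, 2)})
    {U : nat -> 'M[R]_(n, N)} {Us} :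
  mxcvg U Us -> vcvg (fun k => gradn grad (U k)) (gradn grad Us).
Proof.
move=> UU x i z j; rewrite ord1.
(* By adjointness each entry of the gradient is an inner product with a fixed vector. *)
have E V : gradn grad V x i 0 j = mxdot (gradT grad (delta_mx x j)) (col i V).
  by rewrite gradT_adjoint mxdotC mxdot_delta !mxE.
rewrite E; under eq_fun do rewrite E.
by apply: cvg_mxdot; [exact: mxcvg_cst|exact: mxcvg_col].
Qed.

Lemma mxcvg_gradTn {n N : nat} (grad : {linear 'cV[R]_n -> 'M[R]_(n, 2)})
    {L : nat -> 'M['rV[R]_2]_(n, N)} {Ls} :
  vcvg L Ls -> mxcvg (fun k => gradTn grad (L k)) (gradTn grad Ls).
Proof.
move=> LL x i.
have E M : gradTn grad M x i = mxdot (vcol i M) (grad (delta_mx x 0)).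
  by rewrite -gradT_adjoint mxdot_delta mxE.
rewrite E; under eq_fun do rewrite E.
apply: cvg_mxdot; last exact: mxcvg_cst.
by move=> y j; rewrite mxE; under eq_fun do rewrite mxE; exact: LL.
Qed.

End Entrywise.

Lemma is_minimizer_limit {R : realType} {n N s : nat} {nu : 'rV[R]_s -> R}
    (hnu : is_norm nu) {I : 'M[R]_(n, s)} {W : nat -> 'M[R]_(n, N)}
    {C : nat -> 'M[R]_(N, s)} {Ws Cs} i :
  (forall k, is_minimizer (fitting nu I (col i (W k))) (row i (C k))) ->
  mxcvg W Ws -> mxcvg C Cs ->
  is_minimizer (fitting nu I (col i Ws)) (row i Cs).
Proof.
move=> Cmin WW CC c.
have fit (c' : nat -> 'rV[R]_s) cs : mxcvg c' cs ->
    fitting nu I (col i (W k)) (c' k) @[k --> \oo] --> fitting nu I (col i Ws) cs.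
  move=> cc; apply: cvg_sumr => x; apply: cvgM.
    by apply: cvg_norm_entrywise => //; apply: mxcvgB => //; exact: mxcvg_cst.
  exact: mxcvg_col.
apply: ler_cvg_to (fit _ _ (mxcvg_row i CC)) (fit _ _ (mxcvg_cst c)) _.
by apply: nearW => k; exact: Cmin.
Qed.

Lemma simplex_limit {R : realType} {n N : nat} {W : nat -> 'M[R]_(n, N)} {Ws} :
  (forall k, simplex (W k)) -> mxcvg W Ws -> simplex Ws.
Proof.
move=> WS WW x; split=> [i|].
  apply: ler_cvg_to (cvg_cst 0) (WW x i) _.
  by apply: nearW => k; case: (WS k x).
have : \sum_i W k x i @[k --> \oo] --> \sum_i Ws x i by apply: cvg_sumr => i; exact: WW.
have -> : (fun k => \sum_i W k x i) = cst 1.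
  by apply/funext => k; case: (WS k x).
by move/cvg_unique; apply; [exact: Rhausdorff|exact: cvg_cst].
Qed.

(** The D-inequality is tested at [gradn grad V] and the W-inequality at [V]. In their sum the
    multipliers pair with [V - W] through [gradTn grad LD + LW = 0] and disappear. The last bracket
    is an error made of residuals only. *)
Lemma step_energy_le {R : realType} {n N s : nat} {nu : 'rV[R]_s -> R}
    {I : 'M[R]_(n, s)} {lam r : R} {grad : {linear 'cV[R]_n -> 'M[R]_(n, 2)}}
    {D W C C' U LD LW} (V : 'M[R]_(n, N)) :
  step_optimal nu I lam r grad D W C C' U LD LW -> simplex V ->
  \sum_i \sum_x enorm (D x i) + lam * mxdot (absdiff nu I C) W <=
  \sum_i \sum_x enorm (gradn grad V x i) + lam * mxdot (absdiff nu I C) V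
  + (\sum_i \sum_x enorm (gradn grad W x i - D x i)
     - r * (\sum_i \sum_x
              mxdot (gradn grad U x i - D x i) (gradn grad (V - W) x i)
            + mxdot (U - W) (V - W))).
Proof.
move=> [hD [_ hW] _ hL] /hW.
rewrite !mxdotBl mxdotDl !mxdotZl (mxdotBr _ _ (absdiff _ _ _)) mulrDr.
rewrite -(mxdotBl U W).
have := congr1 (fun L => mxdot L (V - W)) hL.
rewrite /= mxdotDl -gradTn_adjoint mxdot0l.
suff : \sum_i \sum_x enorm (D x i)
    + \sum_i \sum_x mxdot (LD x i) (gradn grad (V - W) x i)
    + r * \sum_i \sum_x
            mxdot (gradn grad U x i - D x i) (gradn grad (V - W) x i)
    <= \sum_i \sum_x enorm (gradn grad V x i)
       + \sum_i \sum_x enorm (gradn grad W x i - D x i) by lra.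
rewrite mulr_sumr -!big_split /=; apply: ler_sum => i _.
rewrite mulr_sumr -!big_split /=; apply: ler_sum => x _.
have := hD x i (gradn grad V x i); set G := LD x i + _.
have -> : gradn grad V x i - D x i =
    gradn grad (V - W) x i + (gradn grad W x i - D x i).
  by rewrite gradnB addrA subrK.
rewrite mxdotDr {1}/G mxdotDl mxdotZl.
(* The unit bound on the subgradient [G] controls its pairing with the residual
   [gradn grad W x i - D x i] without any bound on [LW]. *)
have G1 : enorm G <= 1 by apply: (subgrad_enorm_le1 (D x i)); exact: hD.
have := cauchy_schwarz (- G) (gradn grad W x i - D x i).
rewrite mxdotNl -(scaleN1r G) enormZ normrN1 mul1r.
have := ler_wpM2r (enorm_ge0 (gradn grad W x i - D x i)) G1.
by rewrite mul1r; lra.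
Qed.

(** * Limits of the optimality conditions along a subsequence *)

Section Limits.
Context {R : realType} {n N s : nat} {nu : 'rV[R]_s -> R} (hnu : is_norm nu).
Context {I : 'M[R]_(n, s)} {lam r : R}.
Context {grad : {linear 'cV[R]_n -> 'M[R]_(n, 2)}}.
Context {D : nat -> 'M['rV[R]_2]_(n, N)} {W : nat -> 'M[R]_(n, N)}.
Context {C C' : nat -> 'M[R]_(N, s)} {U : nat -> 'M[R]_(n, N)}.
Context {LD : nat -> 'M['rV[R]_2]_(n, N)} {LW : nat -> 'M[R]_(n, N)}.
(** In the application [D], [W] and [C'] are one iteration ahead of [C], [U], [LD] and [LW]: the
    W-step uses the old [C], while minimality concerns the new one. *)
Hypothesis step : forall k,
  step_optimal nu I lam r grad (D k) (W k) (C k) (C' k) (U k) (LD k) (LW k).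
Context {Us : 'M[R]_(n, N)} {Cs : 'M[R]_(N, s)}.
Hypotheses (hD : vcvg D (gradn grad Us)) (hW : mxcvg W Us).
Hypotheses (hC : mxcvg C Cs) (hC' : mxcvg C' Cs) (hU : mxcvg U Us).

Lemma c_stationary_limit i : c_stationary nu I (col i Us) (row i Cs).
Proof.
apply: minimizer_c_stationary => // [x|].
  have WS k : simplex (W k) by have [_ []] := step k.
  by rewrite mxE; case: (simplex_limit WS hW x).
by apply: (is_minimizer_limit hnu i _ hW hC') => k; have [_ _] := step k.
Qed.

Lemma simplex_Us : simplex Us.
Proof. by apply: simplex_limit hW => k; have [_ []] := step k. Qed.

Lemma KKT_limit LDs LWs : vcvg LD LDs -> mxcvg LW LWs ->
  is_KKT nu I lam grad (gradn grad Us) Us Cs Us LDs LWs.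
Proof.
move=> hLD hLW; split.
- move=> x i; exists (LDs x i); last by rewrite subrr.
  move=> v /=; rewrite -EFinD lee_fin.
  have G : mxcvg (fun k => LD k x i + r *: (gradn grad (U k) x i - D k x i))
      (LDs x i).
    rewrite -[X in mxcvg _ X]addr0 -(scaler0 _ r) -(subrr (gradn grad Us x i)).
    apply: mxcvgD; first exact: hLD.
    by apply/mxcvgZ/mxcvgB; [exact: vcvg_gradn|exact: hD].
  have L : enorm (D k x i) +
      mxdot (LD k x i + r *: (gradn grad (U k) x i - D k x i)) (v - D k x i)
      @[k --> \oo] --> enorm (gradn grad Us x i) + mxdot (LDs x i) (v - gradn grad Us x i).
    apply: cvgD; first exact: cvg_enorm (hD x i).
    by apply: cvg_mxdot => //; apply: mxcvgB; [exact: mxcvg_cst|exact: hD].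
  apply: ler_cvg_to L (cvg_cst (enorm v)) _.
  by apply: nearW => k; have [+ _ _ _] := step k; apply.
(* The limit of the variational inequality says that this matrix is normal to the simplex at
   [Us]. *)
- exists (LWs - lam *: absdiff nu I Cs); last first.
    by rewrite -[X in _ + X]opprB subrr.
  move=> V; rewrite /indic_simplex (mem_set simplex_Us) add0e.
  case: ifPn => [|_]; last by rewrite leey.
  rewrite inE lee_fin => VS.
  have G : mxcvg (fun k => LW k + r *: (U k - W k) - lam *: absdiff nu I (C k))
      (LWs - lam *: absdiff nu I Cs).
    rewrite -[X in mxcvg _ (X - _)]addr0 -(scaler0 _ r) -(subrr Us).
    apply: mxcvgB; last exact/mxcvgZ/mxcvg_absdiff.
    by apply: mxcvgD => //; apply/mxcvgZ/mxcvgB.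
  apply: ler_cvg_to (cvg_mxdot G (mxcvgB (mxcvg_cst V) hW)) (cvg_cst 0) _.
  by apply: nearW => k; have [_ [_ +] _ _] := step k; apply.
- exact: c_stationary_limit.
- move=> x i; suff /matrixP/(_ x i) : gradTn grad LDs + LWs = 0 by rewrite mxE [RHS]mxE.
  apply: mxcvg_unique (mxcvg_cst 0).
  have <- : (fun k => gradTn grad (LD k) + LW k) = fun=> 0.
    by apply/funext => k; have [] := step k.
  by apply: mxcvgD => //; exact: mxcvg_gradTn.
- by split=> x i; rewrite subrr.
Qed.

Lemma energyE V : energy nu I lam grad V Cs =
  \sum_i \sum_x enorm (gradn grad V x i) + lam * mxdot (absdiff nu I Cs) V.
Proof.
rewrite /energy; under eq_bigr do rewrite big_split.
rewrite big_split /=; congr (_ + _).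
rewrite /mxdot exchange_big mulr_sumr; apply: eq_bigr => i _ /=.
by rewrite mulr_sumr; apply: eq_bigr => x _; rewrite mxE mulrA.
Qed.

Lemma stationary_limit : is_stationary nu I lam grad Cs Us.
Proof.
split=> [V|i]; last exact: c_stationary_limit.
rewrite mxdot0l adde0 /indic_simplex.
rewrite (mem_set simplex_Us) adde0.
case: ifPn => [|_]; last by rewrite addey ?leey.
rewrite inE adde0 lee_fin !energyE => VS.
have Dn (g : nat -> 'M['rV[R]_2]_(n, N)) gs : vcvg g gs ->
    \sum_i \sum_x enorm (g k x i) @[k --> \oo] --> \sum_i \sum_x enorm (gs x i).
  move=> gg; apply: cvg_sumr => i; apply: cvg_sumr => x.
  exact: cvg_enorm (gg x i).
have an (X : nat -> 'M[R]_(n, N)) Xs : mxcvg X Xs ->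
    lam * mxdot (absdiff nu I (C k)) (X k) @[k --> \oo] -->
    lam * mxdot (absdiff nu I Cs) Xs.
  move=> XX; apply: cvgM; first exact: cvg_cst.
  by apply: cvg_mxdot => //; exact: mxcvg_absdiff.
have L := cvgD (Dn _ _ hD) (an _ _ hW).
have e1 : \sum_i \sum_x enorm (gradn grad (W k) x i - D k x i) @[k --> \oo] --> (0 : R).
  have z : 0 = \sum_(i < N) \sum_(x < n) enorm (0 : 'rV[R]_2) :> R.
    by rewrite big1 // => i _; rewrite big1 // => x _; rewrite /enorm mxdot0l sqrtr0.
  rewrite [X in _ --> X]z; apply: cvg_sumr => i; apply: cvg_sumr => x.
  apply: cvg_enorm.
  by rewrite -(subrr (gradn grad Us x i)); apply: mxcvgB; [exact: vcvg_gradn|exact: hD].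
have e2 : \sum_i \sum_x mxdot (gradn grad (U k) x i - D k x i)
    (gradn grad (V - W k) x i) @[k --> \oo] --> (0 : R).
  have z : 0 = \sum_(i < N) \sum_(x < n) mxdot 0 (gradn grad (V - Us) x i) :> R.
    by rewrite big1 // => i _; rewrite big1 // => x _; rewrite mxdot0l.
  rewrite [X in _ --> X]z; apply: cvg_sumr => i; apply: cvg_sumr => x; apply: cvg_mxdot.
    by rewrite -(subrr (gradn grad Us x i)); apply: mxcvgB; [exact: vcvg_gradn|exact: hD].
  by apply: vcvg_gradn; apply: mxcvgB => //; exact: mxcvg_cst.
have e3 : mxdot (U k - W k) (V - W k) @[k --> \oo] --> (0 : R).
  rewrite -(mxdot0l (V - Us)) -(subrr Us).
  by apply: cvg_mxdot; apply: mxcvgB => //; exact: mxcvg_cst.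
(* The right-hand side of [step_energy_le] tends to the energy of [V], as its three error terms
   vanish. *)
have Rl := cvgD (cvgD (cvg_cst (\sum_i \sum_x enorm (gradn grad V x i)))
  (an _ _ (mxcvg_cst V))) (cvgB e1 (cvgM (cvg_cst r) (cvgD e2 e3))).
rewrite addr0 mulr0 subrr addr0 in Rl.
apply: ler_cvg_to (L _) (Rl _ _ _ _ _ _ _) _.
by apply: nearW => k; exact: step_energy_le (step k) VS.
Qed.

End Limits.

(** * Accumulation points *)

(** For each [m] an index at least [m] is chosen whose term lies within [1 / (m + 1)] of [p]. The
    map [phi] tends to infinity but is not claimed to be increasing. *)
Lemma cluster_subseq {R : realType} {T : pseudoMetricType R} {u : nat -> T} {p} :
  cluster (u @ \oo) p ->
  exists2 phi : nat -> nat, phi m @[m --> \oo] --> \oo &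
    u (phi m) @[m --> \oo] --> p.
Proof.
move=> clu; have ex m : exists k, (m <= k)%N /\ ball p m.+1%:R^-1 (u k).
  have [||_ [[k /= mk <-] pk]] := clu (u @` [set k | (m <= k)%N]) (ball p m.+1%:R^-1).
  - by exists m => // k mk; exists k.
  - by apply: nbhsx_ballx; rewrite invr_gt0.
  by exists k.
have [phi phiP] := choice ex; exists phi.
  move=> A [k _ kA]; exists k => // m /= km; apply: kA => /=.
  by apply: leq_trans km _; case: (phiP m).
apply/cvg_ballP => e e0; near=> m.
have [_] := phiP m; apply: le_ball; apply: ltW.
by near: m; exact: near_infty_natSinv_lt (PosNum e0).
Unshelve. all: end_near. Qed.

Lemma entry_continuous {R : realType} {T : pseudoMetricType R} {m p : nat} i j :
  continuous (fun M : 'M[T]_(m, p) => M i j).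
Proof.
move=> M A /nbhs_ballP [e e0 eA]; apply/nbhs_ballP; exists e => // M' [_ MM'].
exact/eA/MM'.
Qed.

Lemma cvg_mxcvg {R : realType} {m p : nat} {X : nat -> 'M[R]_(m, p)} {A} :
  X @ \oo --> A -> mxcvg X A.
Proof. by move=> XA i j; exact: cvg_comp XA (entry_continuous i j A). Qed.

Lemma cvg_vcvg {R : realType} {n N : nat} {X : nat -> 'M['rV[R]_2]_(n, N)} {A} :
  X @ \oo --> A -> vcvg X A.
Proof.
by move=> XA x i; apply: cvg_mxcvg; exact: cvg_comp XA (entry_continuous x i A).
Qed.

Lemma seq_fst {T1 T2 : topologicalType} {u : nat -> T1 * T2} {p : T1 * T2} :
  u @ \oo --> p -> (u k).1 @[k --> \oo] --> p.1.
Proof. by move=> up; exact: cvg_comp up cvg_fst. Qed.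

Lemma seq_snd {T1 T2 : topologicalType} {u : nat -> T1 * T2} {p : T1 * T2} :
  u @ \oo --> p -> (u k).2 @[k --> \oo] --> p.2.
Proof. by move=> up; exact: cvg_comp up cvg_snd. Qed.

Section Successor.
Context {R : realType} {phi : nat -> nat} (hphi : phi m @[m --> \oo] --> \oo).

Lemma mxcvg_subseq {m p : nat} {X : nat -> 'M[R]_(m, p)} {A} :
  mxcvg X A -> mxcvg (fun k => X (phi k)) A.
Proof. by move=> XA i j; exact: cvg_comp hphi (XA i j). Qed.

Lemma mxcvg_succ {m p : nat} (X : nat -> 'M[R]_(m, p)) {A} :
  mxcvg (fun k => X k.+1 - X k) 0 -> mxcvg (fun k => X (phi k)) A ->
  mxcvg (fun k => X (phi k).+1) A.
Proof.
move=> /mxcvg_subseq dX XA.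
have := mxcvgD dX XA; rewrite add0r.
by under eq_fun do rewrite subrK.
Qed.

End Successor.

Theorem theorem3 (R : realType) (n N s : nat) (hN : (1 <= N)%N)
  (hs : s = 1%N \/ s = 3%N)
  (nu : 'rV[R]_s -> R) (hnu : is_norm nu)
  (hnu1 : s = 1%N -> forall (v : 'rV[R]_s) (j : 'I_s), nu v = `|v 0 j|)
  (I : 'M[R]_(n, s)) (lam r : R) (hlam : 0 < lam) (hr : 0 < r)
  (grad : {linear 'cV[R]_n -> 'M[R]_(n, 2)})
  (D : nat -> 'M['rV[R]_2]_(n, N)) (W : nat -> 'M[R]_(n, N))
  (C : nat -> 'M[R]_(N, s)) (U : nat -> 'M[R]_(n, N))
  (LD : nat -> 'M['rV[R]_2]_(n, N)) (LW : nat -> 'M[R]_(n, N))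
  (hZ : is_L1FS nu I lam r grad D W C U LD LW)
  (hdiff : (fun k : nat =>
      (D k.+1, W k.+1, C k.+1, U k.+1, LD k.+1, LW k.+1)
      - (D k, W k, C k, U k, LD k, LW k)) @ \oo --> (0 : L1FS_state R n N s)) :
  (forall (Ds : 'M['rV[R]_2]_(n, N)) (Ws : 'M[R]_(n, N)) (Cs : 'M[R]_(N, s))
     (Us : 'M[R]_(n, N)) (LDs : 'M['rV[R]_2]_(n, N)) (LWs : 'M[R]_(n, N)),
     cluster ((fun k : nat => (D k, W k, C k, U k, LD k, LW k)) @ \oo)
       (Ds, Ws, Cs, Us, LDs, LWs) ->
     is_KKT nu I lam grad Ds Ws Cs Us LDs LWs) /\
  (forall (Cs : 'M[R]_(N, s)) (Us : 'M[R]_(n, N)),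
     cluster ((fun k : nat => (C k, U k)) @ \oo) (Cs, Us) ->
     is_stationary nu I lam grad Cs Us).
Proof.
have rn0 : r != 0 by rewrite gt_eqF.
have [_ _ alg] := hZ.
(* The sextuple is nested to the left, so [h5] down to [h2] concern its first five down to two
   components. *)
have h5 := seq_fst hdiff; have h4 := seq_fst h5; have h3 := seq_fst h4.
have h2 := seq_fst h3.
have dD x i : mxcvg (fun k => D k.+1 x i - D k x i) 0.
  have := cvg_vcvg (seq_fst h2) x i; rewrite mxE; congr (mxcvg _ _).
  by apply/funext => k; rewrite mxE [X in _ + X]mxE.
have dW : mxcvg (fun k => W k.+1 - W k) 0 := cvg_mxcvg (seq_snd h2).
have dC : mxcvg (fun k => C k.+1 - C k) 0 := cvg_mxcvg (seq_snd h3).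
have dU : mxcvg (fun k => U k.+1 - U k) 0 := cvg_mxcvg (seq_snd h4).
have dLD x i : mxcvg (fun k => LD k.+1 x i - LD k x i) 0.
  have := cvg_vcvg (seq_snd h5) x i; rewrite mxE; congr (mxcvg _ _).
  by apply/funext => k; rewrite mxE [X in _ + X]mxE.
have dLW : mxcvg (fun k => LW k.+1 - LW k) 0 := cvg_mxcvg (seq_snd hdiff).
clear hdiff h5 h4 h3 h2.
(* By the multiplier update, this residual is the increment of [LD] divided by [r]. *)
have resD x i : mxcvg (fun k => gradn grad (U k.+1) x i - D k.+1 x i) 0.
  have := mxcvgZ r^-1 (dLD x i); rewrite scaler0.
  congr (mxcvg _ _); apply/funext => k.
  have [_ _ _ _ [-> _]] := alg k.
  by rewrite addrAC subrr add0r scalerA mulVf // scale1r.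
have resW : mxcvg (fun k => U k.+1 - W k.+1) 0.
  have := mxcvgZ r^-1 dLW; rewrite scaler0.
  congr (mxcvg _ _); apply/funext => k.
  have [_ _ _ _ [_ ->]] := alg k.
  by rewrite addrAC subrr add0r scalerA mulVf // scale1r.
(* Convergence of [C] and [U] alone fixes the limits of the next [C], [W] and [D]; this serves both
   claims. *)
have succ phi Cs Us : phi m @[m --> \oo] --> \oo ->
    mxcvg (fun m => C (phi m)) Cs -> mxcvg (fun m => U (phi m)) Us ->
    [/\ mxcvg (fun m => C (phi m).+1) Cs, mxcvg (fun m => W (phi m).+1) Us &
        vcvg (fun m => D (phi m).+1) (gradn grad Us)].
  move=> hphi CC UU; have U1 := mxcvg_succ hphi U dU UU; split.
  - exact: (mxcvg_succ hphi C dC CC).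
  - have := mxcvgB U1 (mxcvg_subseq hphi resW); rewrite subr0.
    by under eq_fun do rewrite subKr.
  - move=> x i; have G1 := vcvg_gradn grad U1 x i.
    have := mxcvgB G1 (mxcvg_subseq hphi (resD x i)).
    by rewrite subr0; under eq_fun do rewrite subKr.
split=> [Ds Ws Cs Us LDs LWs clu|Cs Us clu].
- have [phi hphi Zphi] := cluster_subseq clu.
  have h5 := seq_fst Zphi; have h4 := seq_fst h5; have h3 := seq_fst h4.
  have h2 := seq_fst h3.
  have C0 := cvg_mxcvg (seq_snd h3); have U0 := cvg_mxcvg (seq_snd h4).
  have [C1 W1 D1] := succ _ _ _ hphi C0 U0.
  (* The limit of [W (phi m)] is also that of [W (phi m).+1], which vanishing residuals identify
     with [Us]; [Ds] is treated alike. *)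
  have -> : Ws = Us.
    apply: mxcvg_unique _ W1; apply: (mxcvg_succ hphi W dW).
    exact: cvg_mxcvg (seq_snd h2).
  have -> : Ds = gradn grad Us.
    apply/matrixP => x i; apply: mxcvg_unique _ (D1 x i).
    exact: (mxcvg_succ hphi (fun k => D k x i) (dD x i))
             (cvg_vcvg (seq_fst h2) x i).
  apply: (KKT_limit hnu (fun m => L1FS_step_optimal (phi m) hr hZ)) => //.
  + exact: cvg_vcvg (seq_snd h5).
  + exact: cvg_mxcvg (seq_snd Zphi).
- have [phi hphi Zphi] := cluster_subseq clu.
  have C0 := cvg_mxcvg (seq_fst Zphi); have U0 := cvg_mxcvg (seq_snd Zphi).
  have [C1 W1 D1] := succ _ _ _ hphi C0 U0.
  exact: (stationary_limit hnu (fun m => L1FS_step_optimal (phi m) hr hZ)).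
Qed.
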